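(* Let $S$ be a von Neumann regular and right self-injective ring of characteristic $n$. Let $S'$ be the image of the ring homomorphism $\mathbb{Z}_n[\mathrm{Aut}(S)]\to S$ sending each element of $\mathrm{Aut}(S)$ to the corresponding element of $S$. If $S$ has no homomorphic images isomorphic to $\mathbb{Z}_2$, then $S=S'$. In particular, this is the case (i.e. $S$ has no homomorphic image isomorphic to $\mathbb{Z}_2$, and hence $S=S'$) when $n>0$ and $2$ does not divide $n$.
   Context: Rings are associative with identity. $\mathrm{Aut}(S)$ denotes the group of units of $S$. The characteristic of $S$ is the integer $n\ge 0$ such that the kernel of the canonical ring homomorphism $\mathbb{Z}\to S$, $1\mapsto 1_S$, is $n\mathbb{Z}$. $\mathbb{Z}_n=\mathbb{Z}/n\mathbb{Z}$ and $\mathbb{Z}_0=\mathbb{Z}$; $\mathbb{Z}_n[\mathrm{Aut}(S)]$ is the group ring. Thus $S'$ is the subring of $S$ consisting of the elements which can be written as finite sums of units of $S$. *)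

(* Defs.v *)
From HB Require Import structures.
From mathcomp Require Import all_boot all_order all_algebra finmap.

Set Implicit Arguments.
Unset Strict Implicit.
Unset Printing Implicit Defensive.

Import GRing.Theory.
Local Open Scope fset_scope.
Local Open Scope ring_scope.

Definition von_neumann_regular (S : pzRingType) : Prop :=
  forall a : S, exists x : S, a = a * x * a.

Definition injective_module (R : pzRingType) (E : lmodType R) : Prop :=
  forall (M N : lmodType R) (i : {linear M -> N}) (f : {linear M -> E}),
    injective i -> exists g : {linear N -> E}, forall x, g (i x) = f x.

(* Right S-modules are left modules over the converse ring S^c; on (S^c)^o the
   scaling [a *: x] is the product [x * a] of S. *)
Definition right_self_injective (S : pzRingType) : Prop :=
  injective_module ((S^c)^o : lmodType S^c).

Definition has_characteristic (S : pzRingType) (n : nat) : Prop :=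
  forall m : int, m%:~R = 0 :> S <-> (n%:Z %| m)%Z.

Definition homomorphic_image (S T : pzRingType) : Prop :=
  exists f : {rmorphism S -> T}, forall y, exists x, f x = y.

(* The ring Z/nZ for every n : nat, carried by the integers that are their own
   remainder modulo n. As [modz x 0 = x], this is Z itself for n = 0; it is the
   zero ring for n = 1, unlike ['Z_1]. *)
Section IntMod.
Variable n : nat.

Record intmod := IntMod { imval :> int; _ : (imval %% n)%Z == imval }.

HB.instance Definition _ := [isSub for imval].
HB.instance Definition _ := [Choice of intmod by <:].

Fact im_subproof (x : int) : ((x %% n)%Z %% n)%Z == (x %% n)%Z.
Proof. by rewrite modz_mod. Qed.
Definition im (x : int) : intmod := IntMod (im_subproof x).

Lemma imvalK (x : intmod) : im x = x.
Proof. by apply/val_inj/eqP/(valP x). Qed.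

Definition im_add (x y : intmod) := im (imval x + imval y).
Definition im_opp (x : intmod) := im (- imval x).
Definition im_mul (x y : intmod) := im (imval x * imval y).

Fact im_addA : associative im_add.
Proof. by move=> x y z; apply: val_inj; rewrite /= modzDmr modzDml addrA. Qed.
Fact im_addC : commutative im_add.
Proof. by move=> x y; rewrite /im_add addrC. Qed.
Fact im_add0 : left_id (im 0) im_add.
Proof. by move=> x; rewrite -[RHS]imvalK; apply: val_inj; rewrite /= modzDml add0r. Qed.
Fact im_addN : left_inverse (im 0) im_opp im_add.
Proof. by move=> x; apply: val_inj; rewrite /= modzDml addNr. Qed.
HB.instance Definition _ :=
  GRing.isZmodule.Build intmod im_addA im_addC im_add0 im_addN.

Fact im_mulA : associative im_mul.
Proof. by move=> x y z; apply: val_inj; rewrite /= modzMmr modzMml mulrA. Qed.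
Fact im_mulC : commutative im_mul.
Proof. by move=> x y; rewrite /im_mul mulrC. Qed.
Fact im_mul1 : left_id (im 1) im_mul.
Proof. by move=> x; rewrite -[RHS]imvalK; apply: val_inj; rewrite /= modzMml mul1r. Qed.
Fact im_mulDl : left_distributive im_mul im_add.
Proof.
move=> x y z; apply: val_inj.
by rewrite /= modzMml modzDml modzDmr mulrDl.
Qed.
HB.instance Definition _ :=
  GRing.Zmodule_isComPzRing.Build intmod im_mulA im_mulC im_mul1 im_mulDl.

End IntMod.

(* The group of units of a ring, an element being a pair of a unit and its
   inverse; this avoids requiring invertibility in S to be decidable. *)
Section Units.
Variable S : pzRingType.

Record units := Units {
  uval :> S * S;
  _ : (uval.1 * uval.2 == 1) && (uval.2 * uval.1 == 1) }.

HB.instance Definition _ := [isSub for uval].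
HB.instance Definition _ := [Choice of units by <:].

Lemma units_mulrV (u : units) : u.1 * u.2 = 1.
Proof. by case/andP: (valP u) => /eqP. Qed.
Lemma units_mulVr (u : units) : u.2 * u.1 = 1.
Proof. by case/andP: (valP u) => _ /eqP. Qed.

Lemma units_inj (u v : units) : u.1 = v.1 -> u = v.
Proof.
move=> uv1; apply: val_inj; case: u v uv1 => [[a b] /= +] [[c d] /= +] /= ac.
move=> /andP[_ /eqP ba] /andP[/eqP cd _]; congr pair => //.
by rewrite -[b]mulr1 -cd -ac mulrA ba mul1r.
Qed.

Fact units_one_subproof : ((1 : S) * 1 == 1) && ((1 : S) * 1 == 1).
Proof. by rewrite mulr1 eqxx. Qed.
Definition units_one : units := @Units (1, 1) units_one_subproof.

Fact units_inv_subproof (u : units) :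
  (u.2 * u.1 == 1) && (u.1 * u.2 == 1).
Proof. by rewrite units_mulrV units_mulVr eqxx. Qed.
Definition units_inv (u : units) : units := @Units (u.2, u.1) (units_inv_subproof u).

Fact units_mul_subproof (u v : units) :
  ((u.1 * v.1) * (v.2 * u.2) == 1) && ((v.2 * u.2) * (u.1 * v.1) == 1).
Proof.
rewrite -mulrA [v.1 * _]mulrA units_mulrV mul1r units_mulrV eqxx /=.
by rewrite -mulrA [u.2 * _]mulrA units_mulVr mul1r units_mulVr.
Qed.
Definition units_mul (u v : units) : units :=
  @Units (u.1 * v.1, v.2 * u.2) (units_mul_subproof u v).

Fact units_mulA : associative units_mul.
Proof. by move=> u v w; apply: units_inj; rewrite /= mulrA. Qed.
Fact units_mul1 : left_id units_one units_mul.
Proof. by move=> u; apply: units_inj; rewrite /= mul1r. Qed.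
Fact units_mulr1 : right_id units_one units_mul.
Proof. by move=> u; apply: units_inj; rewrite /= mulr1. Qed.
Fact units_mulV : left_inverse units_one units_inv units_mul.
Proof. by move=> u; apply: units_inj; rewrite /= units_mulVr. Qed.
Fact units_mulVV : right_inverse units_one units_inv units_mul.
Proof. by move=> u; apply: units_inj; rewrite /= units_mulrV. Qed.

HB.instance Definition _ := isGroup.Build units
  units_mulA units_mul1 units_mulr1 units_mulV units_mulVV.

End Units.

(* The group ring R[G], as the finitely supported functions G -> R with the
   convolution product. *)
Definition group_ring (R : pzRingType) (G : groupType) : Type :=
  {fsfun G -> R with 0}.

Section GroupRing.
Variables (R : pzRingType) (G : groupType).
Local Notation RG := (group_ring R G).

HB.instance Definition _ := Choice.on RG.

Definition gr_coef (f : RG) : G -> R := fun x => (f : {fsfun G -> R with 0}) x.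
Definition gr_supp (f : RG) : {fset G} := finsupp (f : {fsfun G -> R with 0}).

Definition gr_zero : RG := [fsfun for fun=> 0].
Definition gr_opp (f : RG) : RG := [fsfun x in gr_supp f => - gr_coef f x].
Definition gr_add (f g : RG) : RG :=
  [fsfun x in gr_supp f `|` gr_supp g => gr_coef f x + gr_coef g x].
Definition gr_one : RG := [fsfun x in [fset 1%g] => 1].
Definition gr_mul (f g : RG) : RG :=
  [fsfun z in [fset (x * y)%g | x in gr_supp f, y in gr_supp g] =>
     \sum_(x <- gr_supp f) gr_coef f x * gr_coef g (x^-1 * z)%g].

Lemma gr_ext (f g : RG) : gr_coef f =1 gr_coef g -> f = g.
Proof. by move=> fg; apply/fsfunP. Qed.

Lemma gr_coef0 (f : RG) x : x \notin gr_supp f -> gr_coef f x = 0.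
Proof. exact: fsfun_dflt. Qed.

Lemma gr_suppPn (f : RG) x : (x \notin gr_supp f) = (gr_coef f x == 0).
Proof. exact: memNfinsupp. Qed.

Lemma gr_zeroE x : gr_coef gr_zero x = 0.
Proof. by rewrite /gr_coef fsfunE. Qed.
Lemma gr_oppE f x : gr_coef (gr_opp f) x = - gr_coef f x.
Proof.
rewrite {1}/gr_coef fsfunE; case: ifPn => // /gr_coef0 ->.
by rewrite oppr0.
Qed.
Lemma gr_addE f g x : gr_coef (gr_add f g) x = gr_coef f x + gr_coef g x.
Proof.
rewrite {1}/gr_coef fsfunE in_fsetU; case: ifPn => //.
by rewrite negb_or => /andP[/gr_coef0-> /gr_coef0->]; rewrite addr0.
Qed.
Lemma gr_oneE x : gr_coef gr_one x = (x == 1%g)%:R.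
Proof. by rewrite /gr_coef fsfunE in_fset1; case: eqP. Qed.
Lemma gr_mulE f g z : gr_coef (gr_mul f g) z =
  \sum_(x <- gr_supp f) gr_coef f x * gr_coef g (x^-1 * z)%g.
Proof.
rewrite {1}/gr_coef fsfunE; case: ifPn => // zD.
rewrite big_seq big1 // => x xf; rewrite [X in _ * X]gr_coef0 ?mulr0 //.
apply: contra zD => yg; apply/imfset2P; exists x => //.
by exists (x^-1 * z)%g => //; rewrite mulVKg.
Qed.

Lemma gr_sum_supp (V : zmodType) (f : RG) (D : {fset G}) (F : G -> R -> V) :
    gr_supp f `<=` D -> (forall x, F x 0 = 0) ->
  \sum_(x <- gr_supp f) F x (gr_coef f x) = \sum_(x <- D) F x (gr_coef f x).
Proof. by move=> sD F0; apply: big_fset_incl => // x _ /gr_coef0 ->. Qed.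

Lemma gr_sum_mul (V : zmodType) (f g : RG) (F : G -> R -> V) :
    (forall x, {morph F x : a b / a + b}) ->
  \sum_(z <- gr_supp (gr_mul f g)) F z (gr_coef (gr_mul f g) z) =
  \sum_(x <- gr_supp f) \sum_(y <- gr_supp g)
     F (x * y)%g (gr_coef f x * gr_coef g y).
Proof.
move=> FD; have F0 x : F x 0 = 0 by apply: (addrI (F x 0)); rewrite -FD !addr0.
pose D := [fset (x * y)%g | x in gr_supp f, y in gr_supp g].
rewrite (@gr_sum_supp _ _ D) //; last first.
  apply/fsubsetP => z; apply: contraLR => zD.
  by rewrite gr_suppPn /gr_coef fsfunE (negbTE zD).
under eq_bigr => z _ do rewrite gr_mulE (big_morph (F z) (FD z) (F0 z)).
rewrite exchange_big /= big_seq [RHS]big_seq; apply: eq_bigr => x xf.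
pose E := [fset (x * y)%g | y in gr_supp g].
rewrite -(@big_fset_incl _ _ _ _ E D) /=; first last.
- move=> z _ zE; rewrite [X in _ * X]gr_coef0 ?mulr0 //.
  apply: contra zE => yg; apply/imfsetP.
  by exists (x^-1 * z)%g => //; rewrite mulVKg.
- apply/fsubsetP => z /imfsetP[y /= yg ->].
  by apply/imfset2P; exists x => //; exists y.
rewrite big_imfset /=; last by move=> y1 y2 _ _ /mulgI.
by apply: eq_bigr => y _; rewrite mulKg.
Qed.

Fact gr_addA : associative gr_add.
Proof. by move=> f g h; apply: gr_ext => x; rewrite !gr_addE addrA. Qed.
Fact gr_addC : commutative gr_add.
Proof. by move=> f g; apply: gr_ext => x; rewrite !gr_addE addrC. Qed.
Fact gr_add0 : left_id gr_zero gr_add.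
Proof. by move=> f; apply: gr_ext => x; rewrite gr_addE gr_zeroE add0r. Qed.
Fact gr_addN : left_inverse gr_zero gr_opp gr_add.
Proof.
by move=> f; apply: gr_ext => x; rewrite gr_addE gr_oppE gr_zeroE addNr.
Qed.
HB.instance Definition _ :=
  GRing.isZmodule.Build RG gr_addA gr_addC gr_add0 gr_addN.

Fact gr_mulA : associative gr_mul.
Proof.
move=> f g h; apply: gr_ext => z; rewrite gr_mulE [RHS]gr_mulE.
rewrite (gr_sum_mul f g (F := fun w c => c * gr_coef h (w^-1 * z)%g)); last first.
  by move=> w a b; rewrite mulrDl.
apply: eq_bigr => x _; rewrite gr_mulE mulr_sumr.
by apply: eq_bigr => y _; rewrite invgM mulrA mulgA.
Qed.
Fact gr_mul1 : left_id gr_one gr_mul.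
Proof.
move=> f; apply: gr_ext => z; rewrite gr_mulE.
rewrite (@gr_sum_supp _ _ [fset 1%g] (fun x c => c * gr_coef f (x^-1 * z)%g)).
- by rewrite big_seq_fset1 gr_oneE eqxx mul1r invg1 mul1g.
- apply/fsubsetP => x; apply: contraLR => x1.
  by rewrite gr_suppPn gr_oneE; rewrite in_fset1 in x1; rewrite (negbTE x1).
- by move=> x; rewrite mul0r.
Qed.
Fact gr_mulr1 : right_id gr_one gr_mul.
Proof.
move=> f; apply: gr_ext => z; rewrite gr_mulE.
rewrite (@gr_sum_supp _ _ (z |` gr_supp f)
           (fun x c => c * gr_coef gr_one (x^-1 * z)%g)).
- rewrite -(@big_fset_incl _ _ _ _ [fset z]) /=.
  + by rewrite big_seq_fset1 gr_oneE mulVg eqxx mulr1.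
  + by rewrite fsub1set in_fset1U eqxx.
  + move=> x _; rewrite in_fset1 gr_oneE => xz.
    rewrite (_ : (x^-1 * z == 1)%g = false) ?mulr0 //; apply: contraNF xz.
    by move=> /eqP xz; rewrite -[z](mulVKg x) xz mulg1.
- exact: fsubsetU1.
- by move=> x; rewrite mul0r.
Qed.
Fact gr_mulDl : left_distributive gr_mul gr_add.
Proof.
move=> f g h; apply: gr_ext => z; rewrite gr_addE !gr_mulE.
pose D := gr_supp f `|` gr_supp g `|` gr_supp (gr_add f g).
have sf : gr_supp f `<=` D by rewrite /D -fsetUA fsubsetUl.
have sg : gr_supp g `<=` D by rewrite /D fsetUAC fsubsetUr.
have sfg : gr_supp (gr_add f g) `<=` D by rewrite /D fsubsetUr.
pose F x (c : R) := c * gr_coef h (x^-1 * z)%g.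
have F0 x : F x 0 = 0 by rewrite /F mul0r.
rewrite (gr_sum_supp sf F0) (gr_sum_supp sg F0) (gr_sum_supp sfg F0).
by rewrite -big_split; apply: eq_bigr => x _; rewrite gr_addE /F mulrDl.
Qed.
Fact gr_mulDr : right_distributive gr_mul gr_add.
Proof.
move=> f g h; apply: gr_ext => z; rewrite gr_addE !gr_mulE -big_split.
by apply: eq_bigr => x _; rewrite gr_addE mulrDr.
Qed.
HB.instance Definition _ :=
  GRing.Zmodule_isPzRing.Build RG gr_mulA gr_mul1 gr_mulr1 gr_mulDl gr_mulDr.

End GroupRing.

(* The ring homomorphism (Z/nZ)[units S] -> S extending the inclusion of the
   units. The characteristic hypothesis is an argument only because the map
   would not be a ring morphism without it. *)
Section UnitHom.
Variables (S : pzRingType) (n : nat).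

Definition unit_hom of has_characteristic S n :=
  fun f : group_ring (intmod n) (units S) =>
    \sum_(u <- gr_supp f) u.1 *~ imval (gr_coef f u) : S.

Variable charS : has_characteristic S n.

Let F (u : units S) (c : intmod n) : S := u.1 *~ imval c.

Fact mulrz_im (x : S) (m : int) : x *~ imval (im n m) = x *~ m.
Proof.
have nS : n%:~R = 0 :> S by apply/charS; rewrite dvdzz.
rewrite -[in LHS]mulrzr -[RHS]mulrzr; congr (_ * _).
by rewrite [in RHS](divz_eq m n) [RHS]intrD intrM nS mulr0 add0r.
Qed.

Let FD u : {morph F u : a b / a + b}.
Proof. by move=> a b; rewrite /F mulrz_im mulrzDr. Qed.

Let F0 u : F u 0 = 0.
Proof. by apply: (addrI (F u 0)); rewrite -FD !addr0. Qed.

Fact unit_hom_is_zmod_morphism : zmod_morphism (unit_hom charS).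
Proof.
move=> f g; rewrite /unit_hom.
pose D := gr_supp f `|` gr_supp g `|` gr_supp (f - g).
have sf : gr_supp f `<=` D by rewrite /D -fsetUA fsubsetUl.
have sg : gr_supp g `<=` D by rewrite /D fsetUAC fsubsetUr.
have sfg : gr_supp (f - g) `<=` D by rewrite /D fsubsetUr.
rewrite (gr_sum_supp sf F0) (gr_sum_supp sg F0) (gr_sum_supp sfg F0).
rewrite -sumrB; apply: eq_bigr => u _.
have -> : gr_coef (f - g) u = gr_coef f u - gr_coef g u.
  by rewrite -gr_oppE -gr_addE.
rewrite FD -[X in _ + X]opprK; congr (_ - _).
by apply: (addIr (F u (- gr_coef g u))); rewrite addNr -FD subrr F0.
Qed.

Fact unit_hom_is_monoid_morphism : monoid_morphism (unit_hom charS).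
Proof.
split=> [|f g]; rewrite /unit_hom.
  rewrite (@gr_sum_supp _ _ _ _ [fset 1%g] F) //; last first.
    apply/fsubsetP => x; apply: contraLR; rewrite in_fset1 => x1.
    by rewrite gr_suppPn gr_oneE (negbTE x1).
  by rewrite big_seq_fset1 gr_oneE eqxx /F mulrz_im.
rewrite (gr_sum_mul f g FD) mulr_suml; apply: eq_bigr => u _.
rewrite mulr_sumr; apply: eq_bigr => v _.
by rewrite /F mulrz_im mulrzAl mulrzAr -mulrzA mulrC.
Qed.

HB.instance Definition _ :=
  GRing.isZmodMorphism.Build _ _ (unit_hom charS) unit_hom_is_zmod_morphism.
HB.instance Definition _ :=
  GRing.isMonoidMorphism.Build _ _ (unit_hom charS) unit_hom_is_monoid_morphism.

Definition unit_subring (x : S) : Prop :=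
  exists f : group_ring (intmod n) (units S), unit_hom charS f = x.

End UnitHom.

(* Main.v *)
(** Let A be the subring of S generated by the units and M the largest ideal of
    S contained in A. Elements of square zero lie in A, so A contains the ideal
    S e S (1 - e) S for every idempotent e. By Zorn's lemma there is a maximal
    isomorphism between two right ideals with zero intersection; injectivity
    turns it into left multiplications, whence regularity shows that the ideals
    are e S and t e S with e in S (1 - e) S e, so that e lies in M. Then M also
    contains an idempotent h with h S = e S + t e S, and by maximality the
    corner (1 - h) S (1 - h) is abelian regular. There every element y has a
    group inverse w, and y + 1 - y w is a unit of S; it follows that y - y w
    lies in M, so that S / M is Boolean. If M were proper, S / M would map onto
    Z_2. *)

Require Import Defs.
From HB Require Import structures.
From mathcomp Require Import all_boot all_order all_algebra.
From mathcomp Require Import finmap boolp classical_sets.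

Set Implicit Arguments.
Unset Strict Implicit.
Unset Printing Implicit Defensive.

Import GRing.Theory.
Local Open Scope classical_set_scope.
Local Open Scope ring_scope.

(** * Zorn's lemma above a given set *)

Lemma zorn_above (T : Type) (P : set (set T)) (A0 : set T) :
    P A0 ->
    (forall F : set (set T), F `<=` P -> total_on F subset -> F !=set0 ->
      P (\bigcup_(X in F) X)) ->
  exists A, [/\ P A, A0 `<=` A & forall B, P B -> A `<=` B -> B `<=` A].
Proof.
(* Adjoining [A0] to every set makes the empty chain harmless: its union becomes [A0]. *)
move=> PA0 Pcup; have [F FP Ftot|A [PA Amax]] :=
  @Zorn_bigcup T [set X | P (X `|` A0)].
  have [F0|/set0P Fn0] := eqVneq F set0.
    by rewrite /= F0 bigcup_set0 set0U.
  rewrite /=; have -> : ((\bigcup_(X in F) X) `|` A0 =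
             \bigcup_(Y in [set X `|` A0 | X in F]) Y)%classic.
    rewrite seteqP; split=> [x [[X FX Xx]|A0x]|x [_ [X FX <-] [Xx|A0x]]].
    - by exists (X `|` A0); [exists X|left].
    - by case: Fn0 => X FX; exists (X `|` A0); [exists X|right].
    - by left; exists X.
    - by right.
  apply: Pcup => [_ [X FX <-]|_ _ [X FX <-] [Y FY <-]|].
  - exact: FP.
  - by have [XY|YX] := Ftot _ _ FX FY; [left|right]; apply: setSU.
  - by case: Fn0 => X FX; exists (X `|` A0); exists X.
exists (A `|` A0); split=> // B PB AB x Bx.
apply: contrapT => nAx; apply: (Amax B).
  rewrite properEneq; split=> [|z Az]; last by apply: AB; left.
  by apply/eqP => AeB; apply: nAx; left; rewrite AeB.
rewrite /= (_ : B `|` A0 = B) //; apply/setUidPl => z A0z.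
by apply: AB; right.
Qed.

(** * Submodules and the extension of maps into [S] *)

Section Submodule.
Variables (R : pzRingType) (V : lmodType R) (Q : submodClosed V).

Definition submodule := {x : V | x \in Q}.
HB.instance Definition _ :=
  [isSub for (@sval V (fun x => x \in Q)) : submodule -> V].
HB.instance Definition _ := [Choice of submodule by <:].
HB.instance Definition _ := [SubChoice_isSubLmodule of submodule by <:].

End Submodule.

Definition is_right_submodule (S : pzRingType) (H : set (S * S)) : Prop :=
  [/\ H 0, forall x y, H x -> H y -> H (x + y)
         & forall x r, H x -> H (x.1 * r, x.2 * r)].

(* Apply injectivity to the two projections of the submodule [H] of [S * S]. *)
Lemma injective_extension (S : pzRingType) (H : set (S * S)) :
    right_self_injective S -> is_right_submodule H ->
    (forall y, H (0, y) -> y = 0) ->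
  exists t, forall x y, H (x, y) -> y = t * x.
Proof.
move=> injS [H0 HD HM] Hfun.
pose V : lmodType S^c := ((S^c)^o * (S^c)^o)%type.
pose Q : {pred V} := fun v => `[< H v >].
have Qsub : submod_closed Q.
  split=> [|a u v]; first exact/asboolP.
  by move=> /asboolP Hu /asboolP Hv; apply/asboolP/HD/Hv/HM.
pose QS : submodClosed V := HB.pack Q (GRing.isSubmodClosed.Build _ _ Q Qsub).
pose fs : submodule QS -> (S^c)^o := fun u => (val u).1.
pose sn : submodule QS -> (S^c)^o := fun u => (val u).2.
have fsL : linear fs by move=> a u v.
have snL : linear sn by move=> a u v.
pose fsl : {linear submodule QS -> (S^c)^o} :=
  HB.pack fs (GRing.isLinear.Build _ _ _ _ fs fsL).
pose snl : {linear submodule QS -> (S^c)^o} :=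
  HB.pack sn (GRing.isLinear.Build _ _ _ _ sn snL).
have fsI : injective fsl.
  move=> u v; rewrite /= /fs => uv; apply: val_inj.
  rewrite [LHS]surjective_pairing [RHS]surjective_pairing uv; congr pair.
  apply/eqP; rewrite -subr_eq0; apply/eqP/Hfun.
  rewrite -(subrr (val u).1) [X in _ - X]uv.
  by have /asboolP := valP (u - v).
have [g gE] := injS _ _ fsl snl fsI.
(* Scaling in [(S^c)^o] is right multiplication in [S], so linearity makes [g] left multiplication
   by [g 1]. *)
exists (g (1 : S)) => x y Hxy.
have Qxy : ((x, y) : V) \in QS by exact/asboolP.
have := gE (exist (fun z => z \in QS) _ Qxy); rewrite /= /fs /sn /= => <-.
by rewrite -[x in LHS]mul1r; exact: (linearZZ g (x : S^c) (1 : S)).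
Qed.

(** * Idempotent generators and maximal isomorphisms of right ideals in a regular ring *)

Section Regular.
Variable S : pzRingType.
Hypothesis regS : von_neumann_regular S.

(** With [v] a quasi-inverse of [c * e], subtracting [e * v * c * e] from [e] leaves an element
    killed by [c]. Iteration imposes several equations while keeping an idempotent generator. *)
Lemma regular_right_annihilator (e c : S) : e * e = e ->
  exists e', e' * e' = e' /\ forall a, e' * a = a <-> e * a = a /\ c * a = 0.
Proof.
move=> ee; have [v dvd] := regS (c * e).
pose e' := e - e * v * c * e.
have ee' : e * e' = e' by rewrite mulrBr !mulrA ee.
have ce' : c * e' = 0.
  by rewrite mulrBr {1}dvd !mulrA subrr.
have fix_e' a : e * a = a -> c * a = 0 -> e' * a = a.
  by move=> ea ca; rewrite mulrBl -!mulrA ea ca !mulr0 subr0.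
exists e'; split=> [|a]; first exact: fix_e'.
split=> [e'a|[ea ca]]; last exact: fix_e'.
by rewrite -e'a !mulrA ee' ce' mul0r.
Qed.

(** Replacing [b] by [c = (1 - e) * b] does not change [e S + b S], and [c * w] is an idempotent
    orthogonal to [e] that generates [c S]. *)
Lemma regular_join (e b : S) : e * e = e ->
  exists h, [/\ h * h = h, h * e = e, h * b = b &
                exists r1 r2, h = e * r1 + b * r2].
Proof.
move=> ee; have [v cvc] := regS ((1 - e) * b).
set c := (1 - e) * b in cvc.
pose w := v * (1 - e); pose h := e + c * w.
have he : h * e = e.
  rewrite /h /w mulrDl -!mulrA [(1 - e) * e]mulrBl mul1r ee subrr.
  by rewrite !mulr0 addr0.
have hb : h * b = b.
  rewrite /h mulrDl /w (mulrA c) -[c * v * _ * _]mulrA -/c -cvc /c.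
  by rewrite mulrBl mul1r addrC subrK.
have hE : h = e * (1 - b * w) + b * w.
  by rewrite mulrBr mulr1 /h /c -mulrA mulrBl mul1r -addrA [- _ + _]addrC.
exists h; split=> //; last by eexists; eexists; exact: hE.
by rewrite [X in _ * X]hE mulrDr !mulrA he hb -mulrA -hE.
Qed.

(* [H] is the graph of an isomorphism between right ideals with zero
   intersection: as [0] is in [H], the second clause also makes [H] functional
   and injective. *)
Definition disjoint_iso (H : set (S * S)) : Prop :=
  is_right_submodule H /\
  forall x y, H x -> H y -> x.1 = y.2 -> x.2 = 0 /\ y.1 = 0.

(** Zorn applies because each closure condition involves at most two pairs, and two pairs in the
    union of a chain lie in one member. *)
Lemma maximal_disjoint_iso : exists H, disjoint_iso H /\
  forall H', disjoint_iso H' -> H `<=` H' -> H' `<=` H.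
Proof.
have [||H [HP _ Hmax]] := @zorn_above _ disjoint_iso [set 0].
- split=> [|_ _ -> -> //]; split=> // [_ _ -> ->|_ r ->] /=.
    by rewrite addr0.
  by rewrite !mul0r.
- move=> F FP Ftot [X0 FX0].
  have dir x y : (\bigcup_(X in F) X) x -> (\bigcup_(X in F) X) y ->
      exists X, [/\ F X, X x & X y].
    move=> [X FX Xx] [Y FY Yy]; have [XY|YX] := Ftot _ _ FX FY.
      by exists Y; split=> //; exact: XY.
    by exists X; split=> //; exact: YX.
  split.
    split=> [|x y Fx Fy|x r [X FX Xx]].
    - by exists X0 => //; case: (FP _ FX0) => -[].
    - have [X [FX Xx Xy]] := dir _ _ Fx Fy.
      by exists X => //; case: (FP _ FX) => -[_ XD _] _; exact: XD.
    - by exists X => //; case: (FP _ FX) => -[_ _ XM] _; exact: XM.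
  move=> x y Fx Fy; have [X [FX Xx Xy]] := dir _ _ Fx Fy.
  by case: (FP _ FX) => _; apply.
- by exists H.
Qed.

Lemma disjoint_iso_swap (H : set (S * S)) :
  disjoint_iso H -> disjoint_iso [set x | H (x.2, x.1)].
Proof.
move=> [[H0 HD HM] Hdis]; split; first split=> // [[a b] [c d]|[a b] r].
- exact: HD.
- exact: HM.
by move=> x y Hx Hy /esym yx; have [] := Hdis _ _ Hy Hx yx.
Qed.

(** On the direct sum of the domain and the image, the map that is [H] on the domain and zero on the
    image extends to [S] by injectivity. *)
Lemma disjoint_iso_extension (H : set (S * S)) :
    right_self_injective S -> disjoint_iso H ->
  exists t, forall x y, H x -> H y -> t * (x.1 + y.2) = x.2.
Proof.
move=> injS [[H0 HD HM] Hdis].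
have HN x : H x -> H (- x.1, - x.2) by move=> /(HM _ (-1)); rewrite !mulrN1.
pose K := [set z | exists x y, [/\ H x, H y & z = (x.1 + y.2, x.2)]].
have [||t tE] := @injective_extension S K injS.
- split=> [|_ _ [x [y [Hx Hy ->]]] [x' [y' [Hx' Hy' ->]]]|_ r [x [y [Hx Hy ->]]]].
  + by exists 0, 0; rewrite /= addr0.
  + exists (x + x'), (y + y'); split; [exact: HD|exact: HD|].
    by congr pair => /=; rewrite addrACA.
  + exists (x.1 * r, x.2 * r), (y.1 * r, y.2 * r); split; [exact: HM|exact: HM|].
    by rewrite /= mulrDl.
- move=> b [x [y [Hx Hy [/esym/eqP xy ->]]]].
  by case: (Hdis _ _ Hx (HN _ Hy)) => //=; apply/eqP; rewrite -addr_eq0.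
- by exists t => x y Hx Hy; rewrite -(tE _ x.2) //; exists x, y.
Qed.

(* The last clause says that the idempotents of the corner ring
   [(1 - h) S (1 - h)] are central in it. *)
Lemma maximal_halving : right_self_injective S -> exists e h s t : S,
  [/\ [/\ e * e = e, s * e = 0 & s * t * e = e],
      h * h = h, exists r1 r2, h = e * r1 + t * e * r2 &
      forall p z, p * p = p -> h * p = 0 -> p * h = 0 -> h * z = 0 ->
        z * h = 0 -> p * z = z -> z * p = 0 -> z = 0].
Proof.
move=> injS; have [H [Hiso Hmax]] := maximal_disjoint_iso; have [[H0 _ _] _] := Hiso.
have [t tE] := disjoint_iso_extension injS Hiso.
have [s sE] := disjoint_iso_extension injS (disjoint_iso_swap Hiso).
have {}sE x y : H x -> H y -> s * (x.1 + y.2) = y.1.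
  move=> Hx Hy; rewrite -[RHS](sE (y.2, y.1) (x.2, x.1)) 1?addrC //=;
    by rewrite -surjective_pairing.
(* The three equations hold on the domain of [H]; they make [t] injective on [e S] with image
   meeting [e S] in zero. So the graph of [t] on [e S] is a disjoint isomorphism containing [H],
   hence equal to it. *)
have [e1 [ee1 e1E]] := regular_right_annihilator s (mulr1 (1 : S)).
have [e2 [ee2 e2E]] := regular_right_annihilator (t * t) ee1.
have [e [ee eE]] := regular_right_annihilator (s * t - 1) ee2.
have eP a : e * a = a <-> [/\ s * a = 0, t * t * a = 0 & s * t * a = a].
  rewrite eE e2E e1E mul1r mulrBl mul1r; split.
    by move=> [[[_ sa] tta] /eqP]; rewrite subr_eq0 => /eqP.
  by move=> [sa tta ->]; rewrite subrr.
have [se _ ste] : [/\ s * e = 0, t * t * e = 0 & s * t * e = e] by exact/eP.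
have HE x : H x <-> e * x.1 = x.1 /\ x.2 = t * x.1.
  have sub z : H z -> e * z.1 = z.1 /\ z.2 = t * z.1.
    move=> Hz; have := tE _ _ Hz H0; have := tE _ _ H0 Hz.
    have := sE _ _ Hz H0; have := sE _ _ H0 Hz.
    rewrite /= !(addr0, add0r) => sz2 sz1 tz2 tz1.
    by rewrite -tz1; split=> //; apply/eP; rewrite -!mulrA tz1 tz2 sz2.
  split; first exact: sub.
  case: x => a b /= [ea ->].
  pose K := [set z : S * S | e * z.1 = z.1 /\ z.2 = t * z.1].
  have KH : K `<=` H.
    apply: Hmax => [|z]; last exact: sub.
    split.
      split=> [|[a1 b1] [a2 b2] [/= ea1 ->] [/= ea2 ->]|[a1 b1] r [/= ea1 ->]].
      - by split; rewrite /= mulr0.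
      - by split; rewrite /= mulrDr ?ea1 ?ea2.
      - by split; rewrite /= mulrA ?ea1.
    move=> [a1 b1] [a2 b2] [/= /eP[sa1 _ _] ->] [/= /eP[_ _ sta2] ->] a12.
    have a20 : a2 = 0 by rewrite -sta2 -mulrA -a12 sa1.
    by rewrite a12 a20 !mulr0.
  exact: KH.
have [h [hh he hte hE]] := regular_join (t * e) ee.
exists e, h, s, t; split=> // p z pp hp ph hz zh pz zp.
(* Compressing the quasi-inverse [w] keeps [z * w' * z = z] and separates [w' S] from both [h S] and
   [p S]. Then [K] adjoins to [H] the isomorphism from [w' z S] onto [z S]. *)
have [w zwz] := regS z; pose w' := (1 - h - p) * w * p.
have hw' : h * w' = 0 by rewrite /w' !mulrA !mulrBr mulr1 hh subrr hp subr0 !mul0r.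
have pw' : p * w' = 0 by rewrite /w' !mulrA !mulrBr mulr1 ph subr0 pp subrr !mul0r.
have zw'z : z * w' * z = z.
  by rewrite /w' !mulrA !mulrBr mulr1 zh zp !subr0 -mulrA pz -zwz.
clearbody w'.
pose K := [set x : S * S | exists a r,
  e * a = a /\ x = (a + w' * z * r, t * a + z * r)].
have hfix a : e * a = a -> h * a = a /\ h * (t * a) = t * a.
  by move=> ea; rewrite -ea !mulrA he -[h * t * e]mulrA hte.
have Kdis : disjoint_iso K.
  split.
    split=> [|_ _ [a [r [ea ->]]] [b [q [eb ->]]]|_ q [a [r [ea ->]]]] /=.
    - by exists 0, 0; rewrite !mulr0 addr0.
    - exists (a + b), (r + q); rewrite mulrDr ea eb; split=> //.
      by rewrite !mulrDr; congr pair => /=; rewrite addrACA.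
    - exists (a * q), (r * q); rewrite !mulrA ea; split=> //.
      by rewrite !mulrDl.
  move=> _ _ [a [r [ea ->]]] [b [q [eb ->]]] /= eq_ab.
  have [[ha _] [_ htb]] := (hfix _ ea, hfix _ eb).
  have atb : a = t * b.
    move/(congr1 (fun x => h * x)): eq_ab.
    by rewrite !mulrDr ha htb !mulrA hw' hz !mul0r !addr0.
  have wzq : w' * z * r = z * q by move: eq_ab; rewrite atb => /addrI.
  have zq : z * q = 0 by rewrite -pz -mulrA -wzq !mulrA pw' !mul0r.
  have zr : z * r = 0 by rewrite -zw'z -!mulrA [w' * _]mulrA wzq zq mulr0.
  have b0 : b = 0.
    by case/eP: eb => _ _ <-; rewrite -mulrA -atb; case/eP: ea.
  by rewrite atb b0 !mulr0 zr -mulrA zq mulr0 addr0.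
(* By maximality [h] fixes [w' * z], although [h * w' = 0]. *)
have /HE[] : H (w' * z, z).
  apply: (Hmax K) => // [[a b] /HE/= [ea ->]|].
    by exists a, 0; rewrite !mulr0 !addr0.
  by exists 0, 1; rewrite !mulr0 !mulr1 !add0r.
move=> /= /hfix[+ _] _; rewrite !mulrA hw' mul0r => /esym w'z.
by rewrite -zw'z -mulrA w'z mulr0.
Qed.

End Regular.

(** * Two-sided ideals and Boolean quotients *)

Definition is_ideal (S : pzRingType) (I : set S) : Prop :=
  [/\ I 0, forall x y, I x -> I y -> I (x + y)
         & forall a b x, I x -> I (a * x * b)].

Section Ideal.
Variables (S : pzRingType) (I : set S).
Hypothesis idealI : is_ideal I.

Lemma ideal0 : I 0. Proof. by case: idealI. Qed.
Lemma idealD x y : I x -> I y -> I (x + y).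
Proof. by case: idealI => _ + _; apply. Qed.
Lemma idealMl a x : I x -> I (a * x).
Proof. by move=> Ix; rewrite -[a * x]mulr1; case: idealI => _ _; apply. Qed.
Lemma idealMr a x : I x -> I (x * a).
Proof. by move=> Ix; rewrite -[x]mul1r; case: idealI => _ _; apply. Qed.
Lemma idealN x : I x -> I (- x).
Proof. by move/(idealMl (-1)); rewrite mulN1r. Qed.
Lemma idealB x y : I x -> I y -> I (x - y).
Proof. by move=> Ix /idealN; exact: idealD. Qed.

End Ideal.

Lemma maximal_ideal (S : pzRingType) (M : set S) : is_ideal M -> ~ M 1 ->
  exists I, [/\ is_ideal I, M `<=` I, ~ I 1 &
    forall J, is_ideal J -> I `<=` J -> ~ J 1 -> J `<=` I].
Proof.
move=> idM nM1.
have [||I [[idI nI1] MI Imax]] :=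
  @zorn_above _ [set I : set S | is_ideal I /\ ~ I 1] M => //.
  move=> F FP Ftot [X0 FX0]; split; last by case=> X /FP[].
  split=> [|x y [X FX Xx] [Y FY Yy]|a b x [X FX Xx]].
  - by exists X0 => //; by case: (FP _ FX0) => /ideal0.
  - have [XY|YX] := Ftot _ _ FX FY.
      by exists Y => //; case: (FP _ FY) => idY _; exact: (idealD idY (XY _ Xx) Yy).
    by exists X => //; case: (FP _ FX) => idX _; exact: (idealD idX Xx (YX _ Yy)).
  - by exists X => //; have [[_ _ +] _] := FP _ FX; apply.
by exists I; split=> // J idJ IJ nJ1; apply: Imax.
Qed.

(** A maximal ideal [I] above [M] leaves only the cosets [I] and [1 + I], so the indicator of the
    complement of [I] is a ring morphism. *)
Lemma boolean_image_Z2 (S : pzRingType) (M : set S) : is_ideal M -> ~ M 1 ->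
  (forall x, M (x * x - x)) -> homomorphic_image S 'Z_2.
Proof.
move=> idM nM1 Mbool; have [I [idI MI nI1 Imax]] := maximal_ideal idM nM1.
have Ibool x : I (x * x - x) by exact: MI.
have I_or x : I x \/ I (1 - x).
  (* As [J] contains [x], it is either contained in [I] or contains 1. *)
  pose J := [set y | forall b, I (y * b * (1 - x))].
  have idJ : is_ideal J.
    split=> [b|y z Jy Jz b|a c y Jy b]; first by rewrite !mul0r; exact: ideal0.
    - by rewrite !mulrDl; exact: idealD.
    - by rewrite -!mulrA; apply: idealMl => //; rewrite !mulrA -[y * c * b]mulrA.
  have Jx : J x.
    (* The factor [(1 - x) * x] puts [z * z] in [I], and [z] is congruent to [z * z]. *)
    move=> b; set z := x * b * (1 - x).
    have zz : I (z * z).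
      have -> : z * z = x * b * ((1 - x) * x) * (b * (1 - x)) by rewrite /z !mulrA.
      case: (idI) => _ _; apply.
      by rewrite mulrBl mul1r -opprB; exact: idealN.
    by have := idealB idI zz (Ibool z); rewrite opprB addrC subrK.
  have [J1|nJ1] := pselect (J 1).
    by right; have := J1 1; rewrite !mul1r.
  left; apply: (Imax J) => // y Iy b.
  by do 2!apply: idealMr => //.
have I_nor x : I x -> I (1 - x) -> False.
  by move=> Ix Ix1; apply: nI1; have := idealD idI Ix1 Ix; rewrite subrK.
pose f x : 'Z_2 := if `[< I x >] then 0 else 1.
have f0 x : I x -> f x = 0 by rewrite /f => /asboolT ->.
have f1 x : I (1 - x) -> f x = 1.
  by rewrite /f => Ix1; case: asboolP => // Ix; case: (I_nor x).
have I2 : I (1 + 1) by have := Ibool (- 1); rewrite mulrNN mulr1 opprK.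
have fB : zmod_morphism f.
  move=> x y; have [Ix|Ix] := I_or x; have [Iy|Iy] := I_or y.
  - by rewrite !f0 ?subrr //; exact: idealB.
  - rewrite (f0 x Ix) (f1 y Iy) f1; first by apply/val_inj.
    have -> : 1 - (x - y) = (1 + 1) - (1 - y) - x.
      by rewrite !opprB !addrA; congr (_ - _); rewrite addrAC addrK.
    by do 2!apply: idealB => //.
  - rewrite (f1 x Ix) (f0 y Iy) f1 ?subr0 //.
    by rewrite opprB addrCA; exact: idealD.
  - rewrite (f1 x Ix) (f1 y Iy) f0 ?subrr //.
    have -> : x - y = (1 - y) - (1 - x).
      by rewrite opprB [RHS]addrC addrA subrK.
    exact: idealB.
have fM : monoid_morphism f.
  split=> [|x y]; first by rewrite f1 // subrr; exact: ideal0.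
  have [Ix|Ix] := I_or x.
    by rewrite (f0 x Ix) f0 ?mul0r //; exact: (idealMr idI y Ix).
  have [Iy|Iy] := I_or y.
    by rewrite (f0 _ Iy) f0 ?mulr0 //; exact: (idealMl idI x Iy).
  rewrite (f1 x) // (f1 y) // f1 ?mulr1 //.
  have := idealD idI Ix (idealMl idI x Iy).
  by rewrite mulrBr mulr1 addrA subrK.
pose fr : {rmorphism S -> 'Z_2} := HB.pack f
  (GRing.isZmodMorphism.Build _ _ f fB) (GRing.isMonoidMorphism.Build _ _ f fM).
exists fr => y; exists (val y)%:R; rewrite rmorph_nat.
exact: natr_Zp.
Qed.

(** * Subrings containing all units, and their largest ideal *)

Section UnitSums.
Variables (S : pzRingType) (A : set S).
Hypothesis A1 : A 1.
Hypothesis AB : forall x y, A x -> A y -> A (x - y).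
Hypothesis AM : forall x y, A x -> A y -> A (x * y).
Hypothesis Aunit : forall u v, u * v = 1 -> v * u = 1 -> A u.

Let A0 : A 0. Proof. by rewrite -(subrr 1); exact: AB. Qed.
Let AD x y : A x -> A y -> A (x + y).
Proof. by move=> Ax Ay; rewrite -[y]opprK -[- y]sub0r; do 2!apply: AB => //. Qed.

(** The element [1 + x] is a unit with inverse [1 - x]. *)
Lemma sqr0_unit_sum x : x * x = 0 -> A x.
Proof.
move=> xx; rewrite -[x](addrK 1); apply: AB => //.
apply: (@Aunit _ (1 - x)).
  by rewrite mulrDl mulrBr mulr1 xx subr0 mul1r addrC subrK.
by rewrite mulrDr mulr1 mulrBl mul1r xx subr0 addrC subrK.
Qed.

(** The largest two-sided ideal of [S] inside [A]. *)
Definition ideal_core : set S := [set x | forall a b, A (a * x * b)].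

Lemma ideal_core_ideal : is_ideal ideal_core.
Proof.
split=> [a b|x y Mx My a b|c d x Mx a b].
- by rewrite mulr0 mul0r.
- by rewrite mulrDr mulrDl; exact: AD.
- by have := Mx (a * c) (d * b); rewrite !mulrA.
Qed.

Lemma ideal_core_sub x : ideal_core x -> A x.
Proof. by move=> /(_ 1 1); rewrite mulr1 mul1r. Qed.

(* The off-diagonal Peirce components [e S (1 - e)] and [(1 - e) S e] square to
   zero, and together they generate the ideal [S e S (1 - e) S]. *)
Lemma full_complement_core (e s t : S) : e * e = e -> e = s * (1 - e) * t * e ->
  ideal_core e.
Proof.
move=> ee est a b; set e' := 1 - e in est.
have ee' : e * e' = 0 by rewrite mulrBr mulr1 ee subrr.
have e'e : e' * e = 0 by rewrite mulrBl mul1r ee subrr.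
have Aee' x : A (e * x * e').
  by apply: sqr0_unit_sum; rewrite !mulrA -[_ * e' * e]mulrA e'e mulr0 !mul0r.
have Ae'e x : A (e' * x * e).
  by apply: sqr0_unit_sum; rewrite !mulrA -[_ * e * e']mulrA ee' mulr0 !mul0r.
have split1 x : x = e * x + e' * x by rewrite -mulrDl addrC subrK mul1r.
have split2 x : x = x * e + x * e' by rewrite -mulrDr addrC subrK mulr1.
have e'e' : e' * e' = e' by rewrite {1}/e' mulrBl mul1r ee' subr0.
clearbody e'.
have Aee'_gen x y z : A (x * e * y * e' * z).
  (* Of the four Peirce blocks, the off-diagonal ones square to zero and the diagonal ones are
     products of two off-diagonal elements. *)
  rewrite [x]split1 !mulrDl; apply: AD; rewrite [z]split2 mulrDr; apply: AD.
  - have := AM (Aee' (x * e * y)) (Ae'e z).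
    by rewrite !mulrA -[_ * e' * e']mulrA e'e'.
  - by have := Aee' (x * e * y * e' * z); rewrite !mulrA.
  - by have := Ae'e (x * e * y * e' * z); rewrite !mulrA.
  - have := AM (Ae'e x) (Aee' (y * e' * z)).
    by rewrite !mulrA -[_ * e * e]mulrA ee.
have -> : a * e * b = a * e * s * e' * (t * e * b).
  by rewrite -{1}ee {2}est !mulrA.
exact: Aee'_gen.
Qed.

Definition group_inverse (y w : S) : Prop :=
  [/\ y * w = w * y, y * w * y = y & w * y * w = w].

(** Completing [y] and [w] by the complementary idempotent [1 - y * w] gives two mutually inverse
    units. *)
Lemma group_inverse_unit_sum y w : group_inverse y w -> A (y - y * w).
Proof.
have gE a b : group_inverse a b -> (a + (1 - a * b)) * (b + (1 - a * b)) = 1.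
  move=> [ab aba bab].
  have ad : a * (1 - a * b) = 0 by rewrite mulrBr mulr1 ab mulrA aba subrr.
  have db : (1 - a * b) * b = 0 by rewrite mulrBl mul1r ab bab subrr.
  have pd : a * b * (1 - a * b) = 0 by rewrite {1}ab -mulrA ad mulr0.
  have dd : (1 - a * b) * (1 - a * b) = 1 - a * b by rewrite mulrBl mul1r pd subr0.
  by rewrite mulrDl mulrDr ad addr0 mulrDr db dd add0r addrC subrK.
move=> yw; have [c yc cy] := yw.
have wy : group_inverse w y by split.
rewrite -[y - y * w](addrK 1); apply: AB => //.
rewrite -addrA [- _ + _]addrC; apply: (@Aunit _ (w + (1 - y * w))).
  exact: gE.
by rewrite c; exact: gE.
Qed.

(* Up to the core, every element lies in the corner [g S g], [g = 1 - h], an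
   abelian regular ring; there [y] and the idempotent [y * w] differ by a sum
   of units, and so do [a * y * b] and [a * (y * w) * b]. *)
Lemma ideal_core_boolean : von_neumann_regular S -> right_self_injective S ->
  forall x, ideal_core (x * x - x).
Proof.
move=> regS injS.
have [e [h [s [t [[ee se ste] hh [r1 [r2 hE]] Tab]]]]] := maximal_halving regS injS.
have idM := ideal_core_ideal.
have Me : ideal_core e.
  by apply: (@full_complement_core e s t); rewrite ?mulrBr ?mulr1 ?se ?subr0.
have Mh : ideal_core h.
  rewrite hE; apply: (idealD idM); first exact: (idealMr idM).
  by apply: (idealMr idM); exact: (idealMl idM).
pose T y := h * y = 0 /\ y * h = 0.
have TM y z : T y -> T z -> T (y * z).
  by move=> [hy _] [_ zh]; split; rewrite ?mulrA ?hy ?mul0r // -mulrA zh mulr0.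
have TB y z : T y -> T z -> T (y - z).
  by move=> [hy yh] [hz zh]; split; rewrite ?mulrBr ?mulrBl ?hy ?yh ?hz ?zh subrr.
have Tg y : T ((1 - h) * y * (1 - h)).
  split; first by rewrite !mulrA [h * (1 - h)]mulrBr mulr1 hh subrr !mul0r.
  by rewrite -[_ * h]mulrA [(1 - h) * h]mulrBl mul1r hh subrr mulr0.
(* Each of [p * y - p * y * p] and [y * p - p * y * p] is an off-diagonal element killed by [Tab],
   used for [p] and for its complement [1 - h - p] in the corner. *)
have Tcentral p y : p * p = p -> T p -> T y -> p * y = y * p.
  move=> pp Tp Ty; have [[hp ph] [hy yh]] := (Tp, Ty).
  have pyp : p * y = p * y * p.
    have [hz zh] : T (p * y - p * y * p).
      by apply: (TB _ _ (TM _ _ Tp Ty)); apply: (TM _ _ (TM _ _ Tp Ty)).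
    apply/eqP; rewrite -subr_eq0; apply/eqP; apply: (Tab p _ pp hp ph hz zh).
      by rewrite mulrBr !mulrA pp.
    by rewrite mulrBl -!mulrA pp subrr.
  have pyp' : y * p = p * y * p.
    have [hz zh] : T (y * p - p * y * p).
      by apply: (TB _ _ (TM _ _ Ty Tp)); apply: (TM _ _ (TM _ _ Tp Ty)).
    apply/eqP; rewrite -subr_eq0; apply/eqP.
    have hq : h * (1 - h - p) = 0 by rewrite !mulrBr mulr1 hh hp subrr subr0.
    have pq : p * (1 - h - p) = 0 by rewrite !mulrBr mulr1 ph pp subr0 subrr.
    apply: (Tab (1 - h - p) _ _ hq _ hz zh).
    - by rewrite 2!mulrBl mul1r hq pq !subr0.
    - by rewrite !mulrBl mul1r hh ph subrr subr0.
    - by rewrite mulrBl mulrBl mul1r hz subr0 mulrBr !mulrA pp subrr subr0.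
    - rewrite mulrBr mulrBr mulr1 zh subr0 mulrBl -!mulrA pp.
      by rewrite subrr.
  by rewrite pyp pyp'.
have Tginv y : T y -> exists w, T w /\ group_inverse y w.
  move=> Ty; have [w0 yw0y] := regS y.
  pose w1 := (1 - h) * w0 * (1 - h); have Tw1 : T w1 by exact: Tg.
  have yw1y : y * w1 * y = y.
    case: Ty => hy yh; rewrite /w1 !mulrA [y * (1 - h)]mulrBr mulr1 yh subr0.
    by rewrite -[_ * y]mulrA [(1 - h) * y]mulrBl mul1r hy subr0 -yw0y.
  clearbody w1; pose w := w1 * y * w1.
  have Tw : T w by exact: (TM _ _ (TM _ _ Tw1 Ty) Tw1).
  have ywy : y * w * y = y by rewrite /w !mulrA yw1y.
  have wyw : w * y * w = w.
    have w1y : w1 * y * w1 * y = w1 * y by rewrite -!mulrA (mulrA y) yw1y.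
    by rewrite /w !mulrA !w1y.
  exists w; split=> //; split=> //; clearbody w.
  have pp : y * w * (y * w) = y * w by rewrite mulrA ywy.
  have qq : w * y * (w * y) = w * y by rewrite mulrA wyw.
  (* Centrality of [y * w] and [w * y] in the corner identifies each with their product. *)
  have pE : y * w = w * y * (y * w).
    rewrite -{1}ywy -[y * w * y]mulrA -(Tcentral _ _ qq (TM _ _ Tw Ty) Ty).
    by rewrite !mulrA.
  have qE : w * y = w * y * (y * w).
    rewrite -{1}ywy (Tcentral _ _ pp (TM _ _ Ty Tw) Ty).
    by rewrite !mulrA.
  by rewrite pE -qE.
have idem y w : group_inverse y w -> y * w * (y * w) = y * w.
  by case=> _ ywy _; rewrite mulrA ywy.
have ginvM y v z w : T y -> T v -> T z -> T w ->
    group_inverse y v -> group_inverse z w ->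
    group_inverse (y * z) (w * v) /\ y * z * (w * v) = y * v * (z * w).
  move=> Ty Tv Tz Tw yv zw.
  have [cyv yvy vyv] := yv; have [czw zwz wzw] := zw.
  have cv := Tcentral _ _ (idem _ _ zw) (TM _ _ Tz Tw) Tv.
  have cy := Tcentral _ _ (idem _ _ zw) (TM _ _ Tz Tw) Ty.
  have cw := Tcentral _ _ (idem _ _ yv) (TM _ _ Ty Tv) Tw.
  have E : y * z * (w * v) = y * v * (z * w).
    by rewrite mulrA -[y * z * w]mulrA -mulrA cv mulrA.
  have E' : w * v * (y * z) = y * v * (z * w).
    by rewrite mulrA -[w * v * y]mulrA -cyv -cw -mulrA -czw.
  split=> //; split; first by rewrite E E'.
    have -> : y * z * (w * v) * (y * z) = y * v * y * (z * w * z).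
      by rewrite E -mulrA [z * w * (y * z)]mulrA cy !mulrA.
    by rewrite yvy zwz.
  have -> : w * v * (y * z) * (w * v) = w * (v * y * v) * (z * w).
    by rewrite -mulrA E !mulrA.
  by rewrite vyv -mulrA -cv !mulrA wzw.
have Mcorner z : ideal_core (z - (1 - h) * z * (1 - h)).
  have -> : z - (1 - h) * z * (1 - h) = h * z + (1 - h) * z * h.
    rewrite [_ * (1 - h)]mulrBr mulr1 opprB addrCA addrC [(1 - h) * z]mulrBl mul1r.
    by rewrite opprB [z + _]addrC subrK.
  by apply: (idealD idM); [exact: (idealMr idM)|exact: (idealMl idM)].
have My y w : T y -> T w -> group_inverse y w -> ideal_core (y - y * w).
  move=> Ty Tw yw a b; set d := y - y * w.
  have [hd dh] : T d by apply: (TB _ _ Ty (TM _ _ Ty Tw)).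
  rewrite -[a * d * b](subrK ((1 - h) * (a * d * b) * (1 - h))).
  apply: AD; first by apply: ideal_core_sub; exact: Mcorner.
  pose a1 := (1 - h) * a * (1 - h); pose b1 := (1 - h) * b * (1 - h).
  have [Ta1 Tb1] : T a1 /\ T b1 by split; exact: Tg.
  have -> : (1 - h) * (a * d * b) * (1 - h) = a1 * d * b1.
    have gd : (1 - h) * d = d by rewrite mulrBl mul1r hd subr0.
    have dg : d * (1 - h) = d by rewrite mulrBr mulr1 dh subr0.
    rewrite /a1 /b1 -[_ * (1 - h) * d]mulrA gd !mulrA.
    by rewrite -[_ * d * (1 - h)]mulrA dg.
  have [va [Tva ava]] := Tginv _ Ta1; have [vb [Tvb bvb]] := Tginv _ Tb1.
  have Asand z v : T z -> T v -> group_inverse z v ->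
      A (a1 * z * b1 - a1 * va * (z * v) * (b1 * vb)).
    move=> Tz Tv zv; have [azv azE] := ginvM _ _ _ _ Ta1 Tva Tz Tv ava zv.
    have [] := ginvM _ _ _ _ (TM _ _ Ta1 Tz) (TM _ _ Tv Tva) Tb1 Tvb azv bvb.
    by rewrite azE => + <-; exact: group_inverse_unit_sum.
  have pp := idem _ _ yw.
  have Ap : group_inverse (y * w) (y * w) by split; rewrite ?pp.
  (* Sandwiching [y] and sandwiching [y * w], its own group inverse, lead to the same idempotent,
     which cancels in the difference. *)
  have := AB (Asand _ _ Ty Tw yw) (Asand _ _ (TM _ _ Ty Tw) (TM _ _ Ty Tw) Ap).
  by rewrite pp opprB addrA subrK mulrBr mulrBl.
move=> x; pose y := (1 - h) * x * (1 - h).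
have [w [Tw yw]] := Tginv y (Tg x).
have Mxp : ideal_core (x - y * w).
  rewrite -[x](subrK y) -addrA; apply: (idealD idM); first exact: Mcorner.
  exact: (My _ _ (Tg x)).
have -> : x * x - x = (x - y * w) * x + y * w * (x - y * w) - (x - y * w).
  by rewrite mulrBl mulrBr idem // addrA subrK opprB addrA subrK.
apply: (idealB idM _ Mxp).
by apply: (idealD idM); [exact: (idealMr idM)|exact: (idealMl idM)].
Qed.

End UnitSums.

(** * The image of the group ring, and the conclusion *)

Section UnitSubring.
Variables (S : pzRingType) (n : nat) (charS : has_characteristic S n).

Lemma unit_subring1 : unit_subring charS 1.
Proof. by exists 1; exact: rmorph1. Qed.

Lemma unit_subringB x y :
  unit_subring charS x -> unit_subring charS y -> unit_subring charS (x - y).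
Proof. by move=> [f <-] [g <-]; exists (f - g); exact: rmorphB. Qed.

Lemma unit_subringM x y :
  unit_subring charS x -> unit_subring charS y -> unit_subring charS (x * y).
Proof. by move=> [f <-] [g <-]; exists (f * g); exact: rmorphM. Qed.

Lemma unit_subring_unit u v : u * v = 1 -> v * u = 1 -> unit_subring charS u.
Proof.
move=> uv vu.
have uvP : ((u, v).1 * (u, v).2 == 1) && ((u, v).2 * (u, v).1 == 1).
  by rewrite /= uv vu eqxx.
pose w : units S := Units uvP.
pose f : group_ring (intmod n) (units S) := [fsfun x in [fset w]%fset => 1].
have fE x : gr_coef f x = if x == w then 1 else 0.
  by rewrite /gr_coef fsfunE in_fset1.
exists f.
(* The coefficient 1 is represented by [1 %% n], which is 0 when [n = 1]; [mulrz_im] covers this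
   case too. *)
rewrite /unit_hom (@gr_sum_supp _ _ _ f [fset w]%fset (fun u c => u.1 *~ imval c)).
- by rewrite big_seq_fset1 fE eqxx mulrz_im.
- apply/fsubsetP => x; apply: contraLR; rewrite in_fset1 => xw.
  by rewrite gr_suppPn fE (negbTE xw).
- by move=> x; rewrite mulrz_im.
Qed.

End UnitSubring.

Theorem corollary2p7 (S : pzRingType) (n : nat)
    (charS : has_characteristic S n)
    (regS : von_neumann_regular S) (injS : right_self_injective S) :
  (~ homomorphic_image S 'Z_2 -> forall x : S, unit_subring charS x) /\
  ((0 < n)%N -> ~~ (2 %| n)%N ->
     ~ homomorphic_image S 'Z_2 /\ forall x : S, unit_subring charS x).
Proof.
have main : ~ homomorphic_image S 'Z_2 -> forall x : S, unit_subring charS x.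
  move=> noZ2 x.
  have A1 := unit_subring1 charS; have AB := @unit_subringB _ _ charS.
  have AM := @unit_subringM _ _ charS; have Au := @unit_subring_unit _ _ charS.
  pose M := ideal_core (unit_subring charS).
  have idM : is_ideal M by exact: ideal_core_ideal.
  have [M1|nM1] := pselect (M 1); last first.
    case: noZ2; apply: (boolean_image_Z2 idM nM1).
    exact: ideal_core_boolean.
  by have := M1 x 1; rewrite !mulr1.
split=> // n_gt0 n_odd; suff noZ2 : ~ homomorphic_image S 'Z_2.
  by split=> //; exact: main.
(* A morphism to ['Z_2] sends [n%:R = 0] to the parity of [n]. *)
case=> f _; have n0 : n%:R = 0 :> S by apply/(charS n%:Z)/dvdzz.
have := congr1 f n0; rewrite rmorph_nat rmorph0 Zp_nat => /(congr1 val) /=.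
by move: n_odd; rewrite dvdn2 negbK modn2 => ->.
Qed.
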